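(* Let $(M,g)$ be a spacetime and let $\ell$ be a (non-vanishing) null vector field on $M$. Then $$\mathfrak{g}_{\ell}:=\{X\in\mathfrak{X}(M)\;:\;[X,\ell]\propto\ell,\ X\text{ is nil-Killing with respect to }\ell\}$$ is a Lie algebra (under the Lie bracket of vector fields), and $$\mathfrak{h}_{\ell}:=\{X\in\{\ell\}^\perp\;:\;[X,\ell]\propto\ell,\ X\text{ is nil-Killing with respect to }\ell\}$$ is an ideal of $\mathfrak{g}_{\ell}$.
   Context: A spacetime is a Lorentzian manifold $(M,g)$; $\mathfrak{X}(M)$ is the space of smooth vector fields. $\{\ell\}^\perp$ denotes the vectors (or vector fields) orthogonal to $\ell$. $[X,\ell]\propto\ell$ means $[X,\ell]=f\ell$ for some $f\in C^\infty(M)$. A symmetric rank two (covariant) tensor field $T$ is nilpotent with respect to the null vector field $\ell$ if at every point $T(\ell,Z)=0$ for all tangent vectors $Z$, and $T(W,\tilde W)=0$ for all $W,\tilde W\in\{\ell\}^\perp$. A vector field $X$ is nil-Killing with respect to $\ell$ if the Lie derivative $\mathcal{L}_Xg$ is nilpotent with respect to $\ell$. *)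

(* Defs.v *)
From HB Require Import structures.
From mathcomp Require Import all_boot all_order all_algebra.
From mathcomp Require Import ring.
From mathcomp Require Import all_classical all_reals all_analysis.

Set Implicit Arguments.
Unset Strict Implicit.
Unset Printing Implicit Defensive.

Import Order.TTheory GRing.Theory Num.Theory.
Import numFieldNormedType.Exports.

Local Open Scope classical_set_scope.
Local Open Scope ring_scope.

Section SmoothOn.
Context {R : realType} {n : nat}.
Implicit Types (U : set 'rV[R]_n) (f g : 'rV[R]_n -> R).

(* C^k on the open set U, through iterated partial derivatives; the values of
   f outside U are irrelevant. *)
Fixpoint Ck_on (k : nat) U f : Prop :=
  (forall x, U x -> {for x, continuous f}) /\
  (if k is k'.+1 then
     forall i : 'I_n, (forall x, U x -> derivable f x (delta_mx 0 i)) /\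
       Ck_on k' U ('D_(delta_mx 0 i) f)
   else True).

Definition smooth_on U f : Prop := forall k, Ck_on k U f.

Lemma near_open_eq U f g x : open U -> (forall y, U y -> f y = g y) -> U x ->
  \near x, f x = g x.
Proof.
by move=> oU fg Ux; apply: filterS fg _; exact: open_nbhs_nbhs.
Qed.

Lemma continuous_at_open_eq U f g x : open U -> (forall y, U y -> f y = g y) ->
  U x -> {for x, continuous f} -> {for x, continuous g}.
Proof.
move=> oU fg Ux cf; rewrite /prop_for /continuous_at -(fg _ Ux).
apply: cvg_trans cf; apply: (@near_eq_cvg _ _ (nbhs x)).
exact: near_open_eq oU fg Ux.
Qed.

Lemma Ck_on_eq k U f g : open U -> (forall x, U x -> f x = g x) ->
  Ck_on k U f -> Ck_on k U g.
Proof.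
move=> oU; elim: k f g => [|k IH] f g fg /= [cf df].
all: have cg x : U x -> {for x, continuous g}
  by move=> Ux; exact: continuous_at_open_eq oU fg Ux (cf x Ux).
- by split.
- split=> // i; have [dfi ckf] := df i.
  split=> [x Ux|].
    by apply: near_eq_derivable (dfi x Ux); exact: (near_open_eq oU fg Ux).
  apply: IH ckf => x Ux.
  by apply: near_eq_derive; exact: (near_open_eq oU fg Ux).
Qed.

Lemma Ck_onW k U f : Ck_on k.+1 U f -> Ck_on k U f.
Proof.
elim: k f => [|k IH] f [cf df]; first by split.
by split=> // i; have [? ?] := df i; split=> //; apply: IH.
Qed.

Lemma Ck_on_cst k U (a : R) : open U -> Ck_on k U (fun=> a).
Proof.
move=> oU; elim: k a => [|k IH] a /=.
all: split=> //; first by move=> x _; exact: cst_continuous.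
move=> i; split=> [x _|]; first exact: derivable_cst.
apply: Ck_on_eq (IH 0) => // x _.
exact/esym/derive_cst.
Qed.

Lemma Ck_onD k U f g : open U -> Ck_on k U f -> Ck_on k U g ->
  Ck_on k U (fun x => f x + g x).
Proof.
move=> oU; elim: k f g => [|k IH] f g /= [cf df] [cg dg].
all: have cfg x : U x -> {for x, continuous (fun x => f x + g x)}
  by move=> Ux; apply: continuousD; [exact: cf | exact: cg].
all: split=> // i; have [dfi kf] := df i; have [dgi kg] := dg i; split=> [x Ux|].
  by apply: derivableD; [exact: dfi | exact: dgi].
apply: Ck_on_eq (IH _ _ kf kg) => // x Ux.
by rewrite deriveD //; [exact: dfi | exact: dgi].
Qed.

Lemma Ck_onM k U f g : open U -> Ck_on k U f -> Ck_on k U g ->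
  Ck_on k U (fun x => f x * g x).
Proof.
move=> oU; elim: k f g => [|k IH] f g.
  move=> /= [cf _] [cg _]; split=> // x Ux.
  by apply: continuousM; [exact: cf | exact: cg].
move=> Hf Hg; have [cf df] := Hf; have [cg dg] := Hg.
split=> [x Ux|i]; first by apply: continuousM; [exact: cf | exact: cg].
have [dfi kf] := df i; have [dgi kg] := dg i; split=> [x Ux|].
  by apply: derivableM; [exact: dfi | exact: dgi].
have H := Ck_onD oU (IH _ _ (Ck_onW Hf) kg) (IH _ _ (Ck_onW Hg) kf).
apply: Ck_on_eq H => // x Ux.
by rewrite deriveM //; [exact: dfi | exact: dgi].
Qed.

End SmoothOn.

(* A chart is a homeomorphism from the open set cdom onto an open set of R^n;
   cmap and cinv are total functions with irrelevant values outside cdom and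
   cmap @` cdom. *)
Record chart (R : realType) (n : nat) (T : topologicalType) := Chart {
  cdom : set T ;
  cmap :> T -> 'rV[R]_n ;
  cinv : 'rV[R]_n -> T ;
  cdom_open : open cdom ;
  cimg_open : open (cmap @` cdom) ;
  cmapK : forall p, cdom p -> cinv (cmap p) = p ;
  cmap_continuous : {within cdom, continuous cmap} ;
  cinv_continuous : {within cmap @` cdom, continuous cinv} }.

(* Atlases are not required to be maximal: an atlas and the maximal atlas
   containing it have the same smooth functions. *)
Record manifold (R : realType) (n : nat) := Manifold {
  mcarrier :> topologicalType ;
  atlas : set (chart R n mcarrier) ;
  manifold_hausdorff : hausdorff_space mcarrier ;
  manifold_second_countable : @second_countable mcarrier ;
  atlas_cover : forall p, exists2 c, atlas c & cdom c p ;
  atlas_compat : forall c c', atlas c -> atlas c' -> forall i : 'I_n,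
    smooth_on (c @` (cdom c `&` cdom c')) (fun x => c' (cinv c x) 0 i) }.

Definition smooth (R : realType) (n : nat) (M : manifold R n) (f : M -> R) :=
  forall c, @atlas R n M c -> smooth_on (c @` cdom c) (f \o cinv c).

Section SmoothFun.
Context {R : realType} {n : nat} (M : manifold R n).

Definition smooth_pred : {pred (M -> R)} := fun f => `[< smooth f >].

Lemma smooth_subring_closed : subring_closed smooth_pred.
Proof.
have mulS f g : smooth (M := M) f -> smooth g -> smooth (f * g).
  by move=> sf sg c ac k; apply: Ck_onM; [exact: cimg_open | exact: sf | exact: sg].
have addS f g : smooth (M := M) f -> smooth g -> smooth (f + g).
  by move=> sf sg c ac k; apply: Ck_onD; [exact: cimg_open | exact: sf | exact: sg].
have cstS (a : R) : smooth (M := M) (cst a).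
  by move=> c ac k; apply: Ck_on_cst; exact: cimg_open.
split=> [|f g /asboolP sf /asboolP sg|f g /asboolP sf /asboolP sg];
  apply/asboolP; [exact: cstS | | exact: mulS].
rewrite (_ : f - g = f + cst (-1) * g); first exact/addS/mulS.
by apply/funext => x; rewrite /= !fctE mulN1r.
Qed.

HB.instance Definition _ :=
  GRing.isSubringClosed.Build (M -> R) smooth_pred smooth_subring_closed.

Lemma smooth_scaler_closed : GRing.scaler_closed smooth_pred.
Proof.
move=> a f /asboolP sf; apply/asboolP => c ac k.
by apply: Ck_onM; [exact: cimg_open | apply: Ck_on_cst; exact: cimg_open | exact: sf].
Qed.

HB.instance Definition _ :=
  GRing.isScaleClosed.Build R (M -> R) smooth_pred smooth_scaler_closed.

Record Cinfty := SmoothFun {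
  smooth_val :> M -> R ;
  smooth_valP : smooth_val \in smooth_pred }.

HB.instance Definition _ := [isSub for smooth_val].
HB.instance Definition _ := [Choice of Cinfty by <:].
HB.instance Definition _ := 
  GRing.SubChoice_isSubComPzRing.Build (M -> R) smooth_pred Cinfty smooth_subring_closed.
HB.instance Definition _ := [SubZmodule_isSubLmodule of Cinfty by <:].

End SmoothFun.

Arguments smooth_pred {R n} M _.

Section Tangent.
Context {R : realType} {n : nat} {M : manifold R n}.

Definition derivation_at (p : M) (v : Cinfty M -> R) : Prop :=
  (forall (a : R) (f g : Cinfty M), v (a *: f + g) = a * v f + v g) /\
  (forall f g : Cinfty M, v (f * g) = v f * g p + f p * v g).

Definition derivation_pred (p : M) : {pred (Cinfty M -> R)} :=
  fun v => `[< derivation_at p v >].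

Lemma derivation_submod_closed p : submod_closed (derivation_pred p).
Proof.
split=> [|a v w /asboolP [lv dv] /asboolP [lw dw]]; apply/asboolP.
  have E f : (0 : Cinfty M -> R) f = 0 by [].
  by split=> [a f g|f g]; rewrite !E ?mulr0 ?mul0r addr0.
have E f : (a *: v + w) f = a * v f + w f by [].
by split=> [b f g|f g]; rewrite !E ?lv ?lw ?dv ?dw; ring.
Qed.

HB.instance Definition _ (p : M) :=
  GRing.isSubmodClosed.Build R (Cinfty M -> R) (derivation_pred p)
    (derivation_submod_closed p).

(* The tangent space at p: the derivations of C^oo(M) at p. *)
Record tangent (p : M) := Tangent {
  tangent_val :> Cinfty M -> R ;
  tangent_valP : tangent_val \in derivation_pred p }.

HB.instance Definition _ (p : M) := [isSub for @tangent_val p].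
HB.instance Definition _ (p : M) := [Choice of tangent p by <:].
HB.instance Definition _ (p : M) := [SubChoice_isSubLmodule of tangent p by <:].

End Tangent.

Arguments tangent {R n M} p.

Section VectorField.
Context {R : realType} {n : nat} (M : manifold R n).

(* A field of tangent vectors X is smooth when p |-> X p f is smooth for every
   smooth f. *)
Record vector_field := VectorField {
  vf_val :> forall p : M, tangent p ;
  vf_smooth : forall f : Cinfty M, (fun p => vf_val p f) \in smooth_pred M }.

Definition vf_app (X : vector_field) (f : Cinfty M) : Cinfty M :=
  SmoothFun (vf_smooth X f).

Lemma vf_eqP (X Y : vector_field) : (forall p, X p = Y p) -> X = Y.
Proof.
case: X Y => [X sX] [Y sY] /= XY.
have E : X = Y by apply: functional_extensionality_dep.
by case: _ / E sY => sY; congr VectorField; apply: Prop_irrelevance.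
Qed.

HB.instance Definition _ := gen_eqMixin vector_field.
HB.instance Definition _ := gen_choiceMixin vector_field.

Lemma vf0_smooth (f : Cinfty M) :
  (fun p : M => (0 : tangent p) f) \in smooth_pred M.
Proof. exact: (rpred0 (smooth_pred M)). Qed.

Definition vf0 := VectorField vf0_smooth.

Lemma vf_opp_smooth (X : vector_field) (f : Cinfty M) :
  (fun p : M => (- X p) f) \in smooth_pred M.
Proof. by have := vf_smooth X f; rewrite -rpredN. Qed.

Definition vf_opp X := VectorField (vf_opp_smooth X).

Lemma vf_add_smooth (X Y : vector_field) (f : Cinfty M) :
  (fun p : M => (X p + Y p) f) \in smooth_pred M.
Proof. exact: rpredD (vf_smooth X f) (vf_smooth Y f). Qed.

Definition vf_add X Y := VectorField (vf_add_smooth X Y).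

Lemma vf_fscale_smooth (h : Cinfty M) (X : vector_field) (f : Cinfty M) :
  (fun p : M => (h p *: X p) f) \in smooth_pred M.
Proof. exact: rpredM (smooth_valP h) (vf_smooth X f). Qed.

Definition vf_fscale h X := VectorField (vf_fscale_smooth h X).

Lemma vf_scale_smooth (a : R) (X : vector_field) (f : Cinfty M) :
  (fun p : M => (a *: X p) f) \in smooth_pred M.
Proof. exact: (rpredZ a (vf_smooth X f)). Qed.

Definition vf_scale a X := VectorField (vf_scale_smooth a X).

Fact vf_addA : associative vf_add.
Proof. by move=> X Y Z; apply: vf_eqP => p; apply: addrA. Qed.
Fact vf_addC : commutative vf_add.
Proof. by move=> X Y; apply: vf_eqP => p; apply: addrC. Qed.
Fact vf_add0 : left_id vf0 vf_add.
Proof. by move=> X; apply: vf_eqP => p; apply: add0r. Qed.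
Fact vf_addN : left_inverse vf0 vf_opp vf_add.
Proof. by move=> X; apply: vf_eqP => p; apply: addNr. Qed.

HB.instance Definition _ := GRing.isZmodule.Build vector_field
  vf_addA vf_addC vf_add0 vf_addN.

Fact vf_scaleA a b X : vf_scale a (vf_scale b X) = vf_scale (a * b) X.
Proof. by apply: vf_eqP => p; apply: scalerA. Qed.
Fact vf_scale1 : left_id 1 vf_scale.
Proof. by move=> X; apply: vf_eqP => p; apply: scale1r. Qed.
Fact vf_scaleDr : right_distributive vf_scale +%R.
Proof. by move=> a X Y; apply: vf_eqP => p; apply: scalerDr. Qed.
Fact vf_scaleDl X : {morph vf_scale^~ X : a b / a + b}.
Proof. by move=> a b; apply: vf_eqP => p; apply: scalerDl. Qed.

HB.instance Definition _ := GRing.Zmodule_isLmodule.Build R vector_field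
  vf_scaleA vf_scale1 vf_scaleDr vf_scaleDl.

Lemma lie_bracket_derivation (X Y : vector_field) (p : M) :
  (fun f : Cinfty M => X p (vf_app Y f) - Y p (vf_app X f)) \in derivation_pred p.
Proof.
have lin (Z : vector_field) a f g :
    vf_app Z (a *: f + g) = a *: vf_app Z f + vf_app Z g.
  apply: val_inj; apply/funext => q /=.
  by have /asboolP [-> _] := tangent_valP (Z q).
have der (Z : vector_field) f g :
    vf_app Z (f * g) = vf_app Z f * g + f * vf_app Z g.
  apply: val_inj; apply/funext => q /=.
  by have /asboolP [_ ->] := tangent_valP (Z q).
have add (v : tangent p) f g : v (f + g) = v f + v g.
  by have /asboolP [l _] := tangent_valP v; rewrite -[f]scale1r l mul1r scale1r.
apply/asboolP; split=> [a f g|f g].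
  rewrite !lin; have /asboolP [-> _] := tangent_valP (X p).
  have /asboolP [-> _] := tangent_valP (Y p).
  by rewrite mulrBr opprD addrACA.
rewrite !der !add.
have /asboolP [_ dX] := tangent_valP (X p).
have /asboolP [_ dY] := tangent_valP (Y p).
rewrite !dX !dY /=; ring.
Qed.

Lemma lie_bracket_smooth (X Y : vector_field) (f : Cinfty M) :
  (fun p : M => Tangent (lie_bracket_derivation X Y p) f) \in smooth_pred M.
Proof.
exact: rpredB (vf_smooth X (vf_app Y f)) (vf_smooth Y (vf_app X f)).
Qed.

Definition lie_bracket (X Y : vector_field) : vector_field :=
  VectorField (lie_bracket_smooth X Y).

End VectorField.

Section Lorentz.
Context {R : realType} {n : nat} {M : manifold R n}.

(* Signature (-, +, ..., +): every tangent space has an orthonormal basis with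
   exactly one timelike vector; in particular the form is nondegenerate. *)
Record lorentz_metric := LorentzMetric {
  metric :> forall p : M, tangent p -> tangent p -> R ;
  lorentz_dim : (2 <= n)%N ;
  metric_sym : forall (p : M) (v w : tangent p), metric v w = metric w v ;
  metric_linear : forall (p : M) (u : tangent p) (a : R) (v w : tangent p),
    metric u (a *: v + w) = a * metric u v + metric u w ;
  metric_signature : forall p : M, exists e : 'I_n -> tangent p,
    (forall v : tangent p, exists c : 'I_n -> R, v = \sum_i c i *: e i) /\
    (forall i j : 'I_n, metric (e i) (e j) =
       if i == j then (if (i : nat) == 0%N then -1 else 1) else 0) ;
  metric_smooth : forall X Y : vector_field M,
    (fun p => metric (X p) (Y p)) \in smooth_pred M }.

Variable g : lorentz_metric.

Definition metric_app (X Y : vector_field M) : Cinfty M :=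
  SmoothFun (metric_smooth g X Y).

Definition tensor2 := forall p : M, tangent p -> tangent p -> R.

(* Some smooth vector field with value v at p (one always exists). *)
Definition extend (p : M) (v : tangent p) : vector_field M :=
  xget 0 [set V : vector_field M | V p = v].

(* (L_X g)(V, W) = X (g(V, W)) - g([X, V], W) - g(V, [X, W]) is C^oo(M)-bilinear
   in V and W, so that its value at p only depends on V p and W p: the choice of
   the extensions of v and w is immaterial. *)
Definition lie_derivative (X : vector_field M) : tensor2 := fun p v w =>
  let V := extend v in let W := extend w in
  X p (metric_app V W) - g p (lie_bracket X V p) (W p)
                       - g p (V p) (lie_bracket X W p).

Definition null_field (l : vector_field M) : Prop :=
  forall p, g p (l p) (l p) = 0 /\ l p <> 0.

Definition nilpotent (l : vector_field M) (T : tensor2) : Prop := forall p,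
  (forall z : tangent p, T p (l p) z = 0) /\
  (forall w w' : tangent p,
     g p w (l p) = 0 -> g p w' (l p) = 0 -> T p w w' = 0).

Definition nil_killing (l X : vector_field M) : Prop :=
  nilpotent l (lie_derivative X).

Definition orthogonal (l : vector_field M) : set (vector_field M) :=
  [set X | forall p, g p (X p) (l p) = 0].

Definition bracket_propto (l X : vector_field M) : Prop :=
  exists f : Cinfty M, lie_bracket X l = vf_fscale f l.

Definition g_alg (l : vector_field M) : set (vector_field M) :=
  [set X | bracket_propto l X /\ nil_killing l X].

Definition h_alg (l : vector_field M) : set (vector_field M) :=
  [set X | [/\ orthogonal l X, bracket_propto l X & nil_killing l X]].

End Lorentz.

Arguments lorentz_metric {R n} M.

Section LieAlgebra.
Context {R : realType} {V : lmodType R}.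
Implicit Types (br : V -> V -> V) (A I : set V).

Definition linear_subspace A : Prop :=
  A 0 /\ forall (a : R) x y, A x -> A y -> A (a *: x + y).

(* A is a real Lie algebra for the restriction of br to A. *)
Record is_lie_algebra br A : Prop := IsLieAlgebra {
  lie_subspace : linear_subspace A ;
  lie_closed : forall x y, A x -> A y -> A (br x y) ;
  lie_linearl : forall (a : R) x y z, A x -> A y -> A z ->
    br (a *: x + y) z = a *: br x z + br y z ;
  lie_linearr : forall (a : R) x y z, A x -> A y -> A z ->
    br x (a *: y + z) = a *: br x y + br x z ;
  lie_alternating : forall x, A x -> br x x = 0 ;
  lie_jacobi : forall x y z, A x -> A y -> A z ->
    br x (br y z) + br y (br z x) + br z (br x y) = 0 }.

Record is_lie_ideal br I A : Prop := IsLieIdeal {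
  ideal_sub : I `<=` A ;
  ideal_subspace : linear_subspace I ;
  ideal_closed : forall x y, A x -> I y -> I (br x y) }.

End LieAlgebra.

(* Main.v *)
From HB Require Import structures.
Require Import Defs.
From mathcomp Require Import all_boot all_order all_algebra.
From mathcomp Require Import ring lra.
From mathcomp Require Import all_classical all_reals all_analysis.

(* Read on vector fields, L_[X,Y] g = L_X (L_Y g) - L_Y (L_X g), and the flow of
   X in g_l preserves both the line of l ([X, l] is proportional to l) and its
   orthogonal complement (because (L_X g)(W, l) = 0), so both parts of nilpotency
   pass to L_[X,Y] g; for the ideal, [X, Y] is orthogonal to l when Y is.
   Transferring this to the pointwise definition of nil-Killing requires that
   tangent vectors extend to global smooth fields and that L_X g is tensorial.
   The former is obtained from a bump function b supported in a chart: the n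
   fields b * d/dx_i are independent at the given point, and the signature axiom
   bounds the dimension of the tangent space by n. *)

Set Implicit Arguments.
Unset Strict Implicit.
Unset Printing Implicit Defensive.

Import Order.TTheory GRing.Theory Num.Theory.
Import numFieldNormedType.Exports.

Local Open Scope classical_set_scope.
Local Open Scope ring_scope.

(** * Differentiability from continuous partial derivatives *)

Section Differentiability.
Context {R : realType}.

(** The differential of [f] is a chosen linear map; [diff_unique] identifies it with [L], and the
    estimate is then the little-o condition. *)
Lemma differentiable_linear_approx (V W : normedModType R) (f : V -> W) (x : V)
    (L : {linear V -> W}) : continuous L ->
  (forall e : R, 0 < e -> \forall h \near 0, `|f (h + x) - (f x + L h)| <= e * `|h|) ->
  differentiable f x.
Proof.
move=> cL approx; suff E : f \o shift x = cst (f x) + L +o_ 0 id.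
  by apply/diff_locallyP; rewrite (diff_unique cL E).
by apply/eqaddoP.
Qed.

Lemma is_derive_line (V : normedModType R) (f : V -> R) (y e : V) (t : R) :
  derivable f (t *: e + y) e ->
  is_derive t 1 (fun u : R => f (u *: e + y)) ('D_e f (t *: e + y)).
Proof.
have E : (fun h : R => h^-1 *: (((fun u : R => f (u *: e + y)) \o shift t) (h *: 1)
          - f (t *: e + y))) =
         (fun h : R => h^-1 *: ((f \o shift (t *: e + y)) (h *: e) - f (t *: e + y))).
  by apply/funext => h /=; rewrite [_%:A]mulr1 scalerDl addrA.
by move=> df; split; rewrite /derivable /derive E.
Qed.

(** The one-variable mean value theorem on the segment between 0 and [s]; as [s] may have either
    sign, [c] is located only by its absolute value. *)
Lemma line_MVT (V : normedModType R) (f : V -> R) (y e : V) (s : R) :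
  (forall c : R, `|c| <= `|s| -> derivable f (c *: e + y) e) ->
  exists2 c : R, `|c| <= `|s| & f (s *: e + y) - f y = s * 'D_e f (c *: e + y).
Proof.
move=> df; pose phi (u : R) : R := f (u *: e + y).
have dphi (u : R) : `|u| <= `|s| -> is_derive u 1 phi ('D_e f (u *: e + y)).
  by move=> us; apply: is_derive_line; exact: df.
have phi0 : phi 0 = f y by rewrite /phi scale0r add0r.
have H (a b : R) : a <= b -> (forall u : R, u \in `[a, b] -> `|u| <= `|s|) ->
    exists2 c : R, `|c| <= `|s| & phi b - phi a = 'D_e f (c *: e + y) * (b - a).
  move=> ab abs; have [| |c cab ->] := @MVT_segment R phi
      (fun u : R => 'D_e f (u *: e + y)) a b ab _ _.
  - by move=> u uab; apply: dphi; apply: abs; exact: subset_itv_oo_cc uab.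
  - by apply: derivable_within_continuous => u uab; have [] := dphi u (abs u uab).
  - by exists c => //; exact: abs.
have [s0|s0] := leP 0 s.
  have [|c cs] := H 0 s s0.
    move=> u; rewrite in_itv /= => /andP[u0 us].
    by rewrite !ger0_norm // (le_trans u0).
  by rewrite phi0 subr0 => E; exists c => //; rewrite mulrC -E.
have [|c cs] := H s 0 (ltW s0).
  move=> u; rewrite in_itv /= => /andP[su u0].
  by rewrite !ler0_norm ?lerN2 // ltW.
rewrite phi0 => E; exists c => //.
by rewrite -opprB E sub0r mulrN opprK mulrC.
Qed.

(** Going from [x] to [h + x] one coordinate at a time, each increment is [h 0 k] times a partial
    derivative at a nearby point, which by continuity is close to the one at [x]. *)
Lemma C1_differentiable n (f : 'rV[R]_n -> R) (x : 'rV[R]_n) :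
  (forall i, \forall y \near x, derivable f y (delta_mx 0 i)) ->
  (forall i, {for x, continuous ('D_(delta_mx 0 i) f)}) ->
  differentiable f x.
Proof.
move=> df cdf.
pose L (h : 'rV[R]_n) := \sum_i h 0 i * 'D_(delta_mx 0 i) f x.
have linL : linear L.
  move=> a u v; rewrite /L scaler_sumr -big_split /=; apply: eq_bigr => i _.
  by rewrite !mxE mulrDl scalerAl.
pose scallM := GRing.isLinear.Build _ _ _ _ _ linL.
pose scalL : {linear 'rV[R]_n -> R} := HB.pack L scallM.
have cL : continuous scalL.
  move=> y; apply: differentiable_continuous.
  have -> : (scalL : 'rV[R]_n -> R) =
      \sum_i ((fun h : 'rV[R]_n => h 0 i) * cst ('D_(delta_mx 0 i) f x)).
    by apply/funext => h; rewrite fct_sumE.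
  apply: differentiable_sum => i.
  by apply: differentiableM; [exact: differentiable_coord|exact: differentiable_cst].
apply: (differentiable_linear_approx cL) => eps eps0.
have n1 : 0 < (n.+1%:R : R) by [].
(* The [n] coordinate errors add up to at most [eps]; dividing by [n.+1] also covers [n = 0]. *)
pose e1 := eps / n.+1%:R.
have e10 : 0 < e1 by rewrite divr_gt0.
have : \forall y \near x, forall i : 'I_n, derivable f y (delta_mx 0 i) /\
    `|'D_(delta_mx 0 i) f x - 'D_(delta_mx 0 i) f y| <= e1.
  have PF : Filter (nbhs x) by exact: nbhs_filter.
  have := @filter_forall _ 'I_n (fun i y => derivable f y (delta_mx 0 i) /\
    `|'D_(delta_mx 0 i) f x - 'D_(delta_mx 0 i) f y| <= e1) (nbhs x) PF.
  apply=> i; apply: filterI; first exact: df.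
  by have /cvgrPdist_le := cdf i; apply.
move=> /nbhs_normP[r /= r0 rP].
apply/nbhs_normP; exists r => //= h.
rewrite /ball_ /= sub0r normrN => hr.
have coord_le (v : 'rV[R]_n) i : `|v 0 i| <= `|v|.
  by rewrite [leRHS]/Num.Def.normr /= mx_normrE; exact: (le_bigmax _ _ (0, i)).
(* The norm is the sup norm, so every point on the coordinate path stays in the ball of radius
   [r]. *)
have norm_le (v : 'rV[R]_n) : (forall i, `|v 0 i| <= `|h 0 i|) -> `|v| <= `|h|.
  move=> vh; rewrite [leLHS]/Num.Def.normr /= mx_normrE.
  apply: bigmax_le => // -[i j] _ /=; rewrite (ord1 i).
  exact: le_trans (vh j) (coord_le h j).
(* Vertices of the path: [w k] keeps the first [k] coordinates of [h], so [w 0] is 0 and [w n] is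
   [h]. *)
pose w k : 'rV[R]_n := \row_i (if (i < k)%N then h 0 i else 0).
have wS (k : 'I_n) : w k.+1 = h 0 k *: delta_mx 0 k + w k.
  apply/rowP => i; rewrite !mxE /= ltnS leq_eqVlt.
  case: (eqVneq i k) => [->|ik]; first by rewrite eqxx ltnn mulr1 addr0.
  by rewrite (_ : (i == k :> nat) = false) ?mulr0 ?add0r //; apply/negbTE.
have step (k : 'I_n) : exists2 z, `|'D_(delta_mx 0 k) f x - z| <= e1 &
    f (w k.+1 + x) - f (w k + x) = h 0 k * z.
  have near_c c : `|c| <= `|h 0 k| ->
      `|x - (c *: delta_mx 0 k + (w k + x))| < r.
    move=> ch; rewrite addrA opprD addrCA subrr addr0 normrN.
    apply: le_lt_trans hr; apply: norm_le => i.
    rewrite !mxE /=; case: (eqVneq i k) => [->|ik].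
      by rewrite ltnn mulr1 addr0.
    by rewrite mulr0 add0r; case: ifP => // _; rewrite normr0.
  have [|c ch E] := @line_MVT _ f (w k + x) (delta_mx 0 k) (h 0 k).
    by move=> c /near_c /rP /(_ k) [].
  exists ('D_(delta_mx 0 k) f (c *: delta_mx 0 k + (w k + x))).
    by have /near_c/rP/(_ k) [] := ch.
  by rewrite wS -addrA E.
have tele : f (h + x) - f x = \sum_(k < n) (f (w k.+1 + x) - f (w k + x)).
  rewrite -(big_mkord xpredT (fun k => f (w k.+1 + x) - f (w k + x))).
  rewrite telescope_sumr //; congr (f (_ + _) - f _).
    by apply/rowP => i; rewrite !mxE ltn_ord.
  by rewrite [w 0%N](_ : _ = 0) ?add0r //; apply/rowP => i; rewrite !mxE.
have -> : f (h + x) - (f x + L h) =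
   \sum_(k < n) (f (w k.+1 + x) - f (w k + x) - h 0 k * 'D_(delta_mx 0 k) f x).
  by rewrite sumrB -tele /L opprD addrA.
apply: le_trans (ler_norm_sum _ _ _) _.
have -> : eps * `|h| = e1 * `|h| *+ n.+1.
  by rewrite -mulr_natr mulrAC /e1 divfK.
apply: (@le_trans _ _ (\sum_(k < n) e1 * `|h|)); last first.
  rewrite sumr_const card_ord; apply: ler_wpMn2l => //.
  by rewrite mulr_ge0 // ltW.
apply: ler_sum => k _; have [z zP ->] := step k.
rewrite -mulrBr normrM mulrC; apply: ler_pM => //.
by rewrite distrC.
Qed.

End Differentiability.

(** * The chain rule and stability of C^k functions *)

Section ChainRule.
Context {R : realType}.

Lemma derive_line (V W : normedModType R) (f : V -> W) (x v : V) :
  'D_v f x = 'D_1 (fun t : R => f (t *: v + x)) 0.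
Proof.
rewrite /derive; set g1 := fun h => h^-1 *: _; set g2 := fun h => h^-1 *: _.
suff -> : g1 = g2 by [].
by apply/funext => h; rewrite /g1 /g2 /= addr0 scale0r add0r [_%:A]mulr1.
Qed.

(** Restricting [phi] to the line through [x] along [v] gives a curve, for which derivability and
    differentiability coincide; the chain rule for differentials then applies. *)
Lemma is_derive_comp (U V W : normedModType R) (h : V -> W) (phi : U -> V)
    (x v : U) : derivable phi x v -> differentiable h (phi x) ->
  is_derive x v (h \o phi) ('D_('D_v phi x) h (phi x)).
Proof.
move=> /derivable1P /derivable1_diffP; set psi := fun t : R => _.
have psi0 : psi 0 = phi x by rewrite /psi scale0r add0r.
move=> dpsi; rewrite -psi0 => dh.
have dc : differentiable (h \o psi) (0 : R) by exact: differentiable_comp.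
split; first by apply/derivable1P/derivable1_diffP.
rewrite derive_line -/(h \o psi) deriveE // diff_comp //= [RHS]deriveE //.
by congr ('d h _ _); rewrite [in RHS]derive_line deriveE.
Qed.

Lemma is_derive_comp1 (U : normedModType R) (h : R -> R) (phi : U -> R)
    (x v : U) (dphi dh : R) :
  is_derive (phi x) 1 h dh -> is_derive x v phi dphi ->
  is_derive x v (h \o phi) (dphi * dh).
Proof.
move=> [/derivable1_diffP dfh <-] [dfphi <-].
apply: is_derive_eq; first exact: is_derive_comp dfphi dfh.
move: ('D_v phi x) => w; rewrite !deriveE //.
have {1}-> : w = w *: 1 by rewrite [RHS]mulr1.
by rewrite linearZ.
Qed.

Lemma is_derive_coord n (x v : 'rV[R]_n) (i : 'I_n) :
  is_derive x v (fun y : 'rV[R]_n => y 0 i) (v 0 i).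
Proof.
have dc : differentiable (fun y : 'rV[R]_n => y 0 i) x by exact: differentiable_coord.
split; first exact: diff_derivable.
have := derive_mx (@derivable_id _ _ x v).
by rewrite derive_id => /rowP /(_ i) ->; rewrite mxE.
Qed.

Lemma derive_row_sum n (h : 'rV[R]_n -> R) (y v : 'rV[R]_n) :
  differentiable h y ->
  'D_v h y = \sum_j v 0 j * 'D_(delta_mx 0 j) h y.
Proof.
move=> dh; rewrite deriveE // [in LHS](row_sum_delta v) linear_sum.
by apply: eq_bigr => j _; rewrite linearZ deriveE.
Qed.

Lemma continuous_row (T : topologicalType) n (phi : T -> 'rV[R]_n) (x : T) :
  (forall j, {for x, continuous (fun y => phi y 0 j)}) ->
  {for x, continuous phi}.
Proof.
move=> cphi; apply/cvgrPdist_le => e e0.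
have H j : \forall y \near x, `|phi x 0 j - phi y 0 j| <= e.
  by have /cvgrPdist_le := cphi j; apply.
have := @filter_forall T 'I_n (fun j y => `|phi x 0 j - phi y 0 j| <= e) (nbhs x)
  (nbhs_filter x) H.
apply: filterS => y ye.
rewrite [leLHS]/Num.Def.normr /= mx_normrE.
by apply: bigmax_le => [|[i j] _ /=]; [exact: ltW|rewrite (ord1 i) !mxE; exact: ye].
Qed.

Lemma Ck_on_sub n k (U V : set 'rV[R]_n) f : V `<=` U -> Ck_on k U f -> Ck_on k V f.
Proof.
move=> VU; elim: k f => [|k IH] f [cf df]; split=> //; first by move=> x /VU /cf.
  by move=> x /VU /cf.
move=> i; have [dfi kf] := df i; split; last exact: IH.
by move=> x /VU /dfi.
Qed.

(** Each clause of [Ck_on] is a condition on the ambient function at single points, so a different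
    [V] may serve at each point. *)
Lemma Ck_on_local n k (U : set 'rV[R]_n) f :
  (forall x, U x -> exists2 V : set 'rV[R]_n, V x & Ck_on k V f) -> Ck_on k U f.
Proof.
elim: k f => [|k IH] f loc; split=> //.
- by move=> x /loc [V Vx [cf _]]; exact: cf.
- by move=> x /loc [V Vx [cf _]]; exact: cf.
move=> i; split=> [x /loc [V Vx [_ /(_ i) [df _]]]|]; first exact: df.
by apply: IH => x /loc [V Vx [_ /(_ i) [_ kf]]]; exists V.
Qed.

Lemma Ck_on_sum n k (U : set 'rV[R]_n) m (f : 'I_m -> 'rV[R]_n -> R) :
  open U -> (forall j, Ck_on k U (f j)) -> Ck_on k U (fun x => \sum_j f j x).
Proof.
move=> oU; elim: m f => [|m IH] f kf.
  by apply: Ck_on_eq (Ck_on_cst k 0 oU) => // x _; rewrite big_ord0.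
apply: Ck_on_eq (Ck_onD oU (kf ord0) (IH (f \o lift ord0) _)) => // [x _|j].
  by rewrite big_ord_recl.
exact: kf.
Qed.

Lemma Ck_on_coord n k (U : set 'rV[R]_n) (i : 'I_n) : open U ->
  Ck_on k U (fun x : 'rV[R]_n => x 0 i).
Proof.
have cont (x : 'rV[R]_n) : {for x, continuous (fun y : 'rV[R]_n => y 0 i)}.
  exact/differentiable_continuous/differentiable_coord.
case: k => [|k] oU; split=> // j; split=> [x _|].
  by have [] := is_derive_coord x (delta_mx 0 j) i.
apply: Ck_on_eq (Ck_on_cst k ((delta_mx 0 j : 'rV[R]_n) 0 i) oU) => // x _.
by have [_ ->] := is_derive_coord x (delta_mx 0 j) i.
Qed.

Lemma Ck_on_differentiable n k (U : set 'rV[R]_n) f x : open U ->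
  Ck_on k.+1 U f -> U x -> differentiable f x.
Proof.
move=> oU [_ df] Ux; apply: C1_differentiable => i; have [dfi kf] := df i.
  by apply: filterS dfi _; exact: open_nbhs_nbhs.
by case: k kf {df} => [|k] [cf _]; exact: cf.
Qed.

(** Induction on [k]: a partial derivative of the composite is a sum of products of partials of the
    components of [phi] with a partial of [h] composed with [phi], and the induction hypothesis
    covers the latter. *)
Lemma Ck_on_comp n m k (U : set 'rV[R]_n) (V : set 'rV[R]_m)
    (h : 'rV[R]_m -> R) (phi : 'rV[R]_n -> 'rV[R]_m) :
  open U -> open V -> (forall x, U x -> V (phi x)) ->
  (forall j, Ck_on k U (fun x => phi x 0 j)) -> Ck_on k V h ->
  Ck_on k U (h \o phi).
Proof.
move=> oU oV UV; elim: k h => [|k IH] h kphi kh.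
all: have ch x : U x -> {for x, continuous (h \o phi)} by
  move=> Ux; apply: continuous_comp;
  [apply: continuous_row => j; have [cp _] := kphi j; exact: cp
  |have [ch _] := kh; apply: ch; exact: UV].
  by split.
split=> // i.
have dphi x : U x -> derivable phi x (delta_mx 0 i).
  move=> Ux; apply/derivable_mxP => a j; rewrite (ord1 a).
  by have [_ /(_ i) [dp _]] := kphi j; exact: dp.
have dh x : U x -> differentiable h (phi x).
  by move=> Ux; apply: (Ck_on_differentiable oV kh); exact: UV.
have D x : U x -> is_derive x (delta_mx 0 i) (h \o phi)
    (\sum_j 'D_(delta_mx 0 i) (fun y => phi y 0 j) x *
            ('D_(delta_mx 0 j) h \o phi) x).
  move=> Ux; have := is_derive_comp (dphi x Ux) (dh x Ux).
  rewrite derive_row_sum; last exact: dh.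
  congr (is_derive _ _ _ _); apply: eq_bigr => j _.
  by rewrite (derive_mx (dphi x Ux)) mxE.
split=> [x Ux|]; first by have [] := D x Ux.
apply: (@Ck_on_eq _ _ k U (fun x => \sum_j
    'D_(delta_mx 0 i) (fun y => phi y 0 j) x * ('D_(delta_mx 0 j) h \o phi) x)) => //.
  by move=> x Ux; have [_ ->] := D x Ux.
apply: Ck_on_sum => // j; apply: Ck_onM => //.
  by have [_ /(_ i) []] := kphi j.
apply: IH; first by move=> j'; apply: Ck_onW.
by have [_ /(_ j) []] := kh.
Qed.

End ChainRule.

(** * Bump functions *)

Section Bump.
Context {R : realType}.

(* The functions t^-k * exp(-1/t), extended by 0 to t <= 0, are closed under
   differentiation up to linear combinations, hence smooth. *)
Definition flat (k : nat) (t : R) : R :=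
  if 0 < t then t^-1 ^+ k * expR (- t^-1) else 0.

Lemma flat_ge0 k t : 0 <= flat k t.
Proof.
rewrite /flat; case: ifP => // t0.
by rewrite mulr_ge0 ?expR_ge0 // exprn_ge0 // invr_ge0 ltW.
Qed.

(** With [u = t^-1], this is the bound exp(u) >= u^(k+1) / (k+1)!. *)
Lemma flat_le k t : flat k t <= (k.+1)`!%:R * `|t|.
Proof.
rewrite /flat; case: ifP => [t0|_]; last by rewrite mulr_ge0.
have u0 : 0 < t^-1 by rewrite invr_gt0.
have := @expR_ge1Dxn R t^-1 k (ltW u0).
set E := expR _ => le_E.
have fact_gt0 : 0 < (k.+1)`!%:R :> R by rewrite ltr0n fact_gt0.
have {le_E} : t^-1 ^+ k.+1 / (k.+1)`!%:R <= E by apply: le_trans le_E; rewrite lerDr.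
rewrite expRN -/E gtr0_norm // ler_pdivrMr // => le_E.
rewrite ler_pdivrMr ?expR_gt0 // -[leLHS](mulKf (lt0r_neq0 u0)) invrK -exprS.
by rewrite [leRHS]mulrAC [leRHS]mulrC ler_pM2l // mulrC.
Qed.

(** Makes the difference quotient of [flat k] at 0 equal to [flat k.+1]. *)
Lemma flatS k t : flat k.+1 t = t^-1 * flat k t.
Proof. by rewrite /flat; case: ifP => _; rewrite ?mulr0 // exprS mulrA. Qed.

Lemma flat_at0 k : flat k 0 = 0.
Proof. by rewrite /flat ltxx. Qed.

Lemma flat_cvg0 k : flat k t @[t --> 0] --> 0.
Proof.
apply/cvgrPdist_le => e e0.
have C0 : 0 < (k.+1)`!%:R :> R by rewrite ltr0n fact_gt0.
apply/nbhs_normP; exists (e / (k.+1)`!%:R) => /=; first by rewrite divr_gt0.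
move=> t; rewrite /ball_ /= !sub0r !normrN ltr_pdivlMr // mulrC => /ltW te.
by rewrite ger0_norm ?flat_ge0 // (le_trans (flat_le _ _)).
Qed.

Lemma is_derive_flat k (t : R) :
  is_derive t 1 (flat k) (flat k.+2 t - k%:R * flat k.+1 t).
Proof.
have [t0|t0|<-] := ltgtP 0 t.
- pose f (s : R) := s^-1 ^+ k * expR (- s^-1).
  apply: (@near_eq_is_derive _ _ _ f).
    by near=> s; rewrite /flat ifT //; near: s; exact: lt_nbhsr.
  have tn0 : t != 0 by rewrite gt_eqF.
  pose u (s : R) := s^-1.
  have du : is_derive t 1 u (- u t ^+ 2).
    apply: is_derive_eq; first exact: is_deriveV tn0 (is_derive_id t 1).
    by rewrite [LHS]mulr1 exprVn.
  have -> : f = u ^+ k * (expR \o (- u)).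
    by apply/funext => s; rewrite /f /u !fctE.
  apply: is_derive_eq.
  rewrite /flat t0 -/(u t) -[_ *: _]/(_ * _) -[X in _ + X]/(_ * _).
  rewrite -[X in _ * X + _]/(_ * _) -[X in _ + _ * X]/(_ * _) /=.
  rewrite -[(- u) t]/(- u t) fctE.
  case: (k) => [|m] /=; first by ring.
  by rewrite !exprS; ring.
- apply: (@near_eq_is_derive _ _ _ (cst 0)).
    by near=> s; rewrite /flat ltNge ltW //; near: s; exact: lt_nbhsl.
  rewrite /flat ltNge (ltW t0) /= mulr0 subr0; exact: is_derive_cst.
- rewrite !flat_at0 mulr0 subr0.
  (* At the gluing point the difference quotient is [flat k.+1] itself, which tends to 0. *)
  have H : h^-1 *: ((flat k \o shift 0) (h *: 1) - flat k 0) @[h --> 0^'] --> (0 : R).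
    have -> : (fun h : R => h^-1 *: ((flat k \o shift 0) (h *: 1) - flat k 0))
        = flat k.+1.
      by apply/funext => h /=; rewrite addr0 flat_at0 subr0 [_%:A]mulr1 flatS.
    by apply: cvg_trans (flat_cvg0 k.+1); apply: cvg_app; exact: cvg_within.
  by split; [apply/cvg_ex; exists 0|apply: cvg_lim].
Unshelve. all: by end_near.
Qed.

(** The affine argument serves both faces of a box in each coordinate. Induction on [m] is for all
    [k] at once, because differentiation raises [k]. *)
Lemma Ck_on_flat n m k (s b : R) (i : 'I_n) :
  Ck_on m setT (fun x : 'rV[R]_n => flat k (s * x 0 i + b)).
Proof.
have D j (x v : 'rV[R]_n) : is_derive x v (fun x : 'rV[R]_n => flat j (s * x 0 i + b))
    (s * v 0 i * (flat j.+2 (s * x 0 i + b) - j%:R * flat j.+1 (s * x 0 i + b))).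
  have dphi : is_derive x v (fun x : 'rV[R]_n => s * x 0 i + b) (s * v 0 i).
    have := is_deriveD (is_deriveZ s (is_derive_coord x v i)) (is_derive_cst b x v).
    by rewrite addr0.
  exact: is_derive_comp1 (is_derive_flat j _) dphi.
have cont j : continuous (fun x : 'rV[R]_n => flat j (s * x 0 i + b)).
  move=> x; apply: (@continuous_comp _ _ _ (fun y : 'rV[R]_n => s * y 0 i + b) (flat j));
    last first.
    apply: differentiable_continuous; apply/derivable1_diffP.
    by have [] := is_derive_flat j (s * x 0 i + b).
  apply: continuousD; last exact: cst_continuous.
  apply: continuousM; first exact: cst_continuous.
  exact/differentiable_continuous/differentiable_coord.
elim: m k => [|m IH] k; split=> //; try by move=> x _; exact: cont.
move=> e; split=> [x _|]; first by have [] := D k x (delta_mx 0 e).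
apply: (@Ck_on_eq _ _ m setT (fun x => s * (delta_mx 0 e : 'rV[R]_n) 0 i *
  (flat k.+2 (s * x 0 i + b) + - k%:R * flat k.+1 (s * x 0 i + b)))) => //.
- exact: openT.
- by move=> x _; have [_ ->] := D k x (delta_mx 0 e); rewrite mulNr.
apply: Ck_onM; [exact: openT|exact/Ck_on_cst/openT|].
apply: Ck_onD; [exact: openT|exact: IH|].
by apply: Ck_onM; [exact: openT|exact/Ck_on_cst/openT|exact: IH].
Qed.

Lemma Ck_on_prod n k (U : set 'rV[R]_n) m (f : 'I_m -> 'rV[R]_n -> R) :
  open U -> (forall j, Ck_on k U (f j)) -> Ck_on k U (fun x => \prod_j f j x).
Proof.
move=> oU; elim: m f => [|m IH] f kf.
  by apply: Ck_on_eq (Ck_on_cst k 1 oU) => // x _; rewrite big_ord0.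
apply: Ck_on_eq (Ck_onM oU (kf ord0) (IH (f \o lift ord0) _)) => // [x _|j].
  by rewrite big_ord_recl.
exact: kf.
Qed.

(** Nonzero exactly on the open cube of half-side [r] around [a]; the factors [1] and [- 1] match
    the affine form of [Ck_on_flat]. *)
Definition box_bump n (a : 'rV[R]_n) (r : R) (x : 'rV[R]_n) : R :=
  \prod_i (flat 0 (1 * x 0 i + (r - a 0 i)) * flat 0 (- 1 * x 0 i + (r + a 0 i))).

Lemma Ck_on_box_bump n k (a : 'rV[R]_n) r : Ck_on k setT (box_bump a r).
Proof.
apply: Ck_on_prod => [|j]; first exact: openT.
by apply: Ck_onM; [exact: openT|exact: Ck_on_flat|exact: Ck_on_flat].
Qed.

Lemma box_bump_center n (a : 'rV[R]_n) r : 0 < r -> box_bump a r a != 0.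
Proof.
move=> r0; apply/prodf_neq0 => i _.
rewrite mul1r mulN1r addrCA subrr addr0 addrCA addNr addr0.
by rewrite /flat r0 expr0 mul1r mulf_neq0 // gt_eqF // expR_gt0.
Qed.

Lemma box_bump_support n (a : 'rV[R]_n) r x : 0 < r ->
  box_bump a r x != 0 -> closed_ball a r x.
Proof.
move=> r0 /prodf_neq0 b0; rewrite closed_ballE // /closed_ball_ /=.
rewrite [leLHS]/Num.Def.normr /= mx_normrE.
apply: bigmax_le => [|[i j] _ /=]; first exact: ltW.
rewrite (ord1 i) !mxE; have := b0 j isT.
rewrite /flat; case: ifP => [h1|_]; last by rewrite mul0r eqxx.
case: ifP => [h2 _|_]; last by rewrite mulr0 eqxx.
by rewrite ler_norml; lra.
Qed.

End Bump.

(** * Extension of tangent vectors to global vector fields *)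

Section FromChart.
Context {R : realType} {n : nat} {M : manifold R n}.

Lemma chart_image_open (c : chart R n M) (A : set M) :
  open A -> open (c @` (cdom c `&` A)).
Proof.
move=> oA.
have -> : c @` (cdom c `&` A) = (c @` cdom c) `&` (cinv c @^-1` A).
  apply/seteqP; split=> x /=.
    move=> [q [cq Aq] <-]; split; first by exists q.
    by rewrite cmapK.
  by move=> [[q cq <-]]; rewrite cmapK // => Aq; exists q.
rewrite openE => x [Ux Ax]; apply: filterI.
  by apply: open_nbhs_nbhs; split => //; exact: cimg_open.
have := @cinv_continuous _ _ _ c.
rewrite (continuous_open_subspace _ (@cimg_open _ _ _ c)) => /(_ x (mem_set Ux)).
by apply; apply: open_nbhs_nbhs.
Qed.

Definition chart_ext (c : chart R n M) (h : 'rV[R]_n -> R) (q : M) : R :=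
  if `[< cdom c q >] then h (c q) else 0.

Lemma chart_extE c h q : cdom c q -> chart_ext c h q = h (c q).
Proof. by move=> cq; rewrite /chart_ext; case: asboolP. Qed.

(** The support lies in [K], the preimage in [M] of a closed ball, which is compact and hence closed
    as [M] is Hausdorff. Near a point of [cdom c] the function is [h] after a transition map; near
    any other point, the complement of [K] is a neighbourhood where it vanishes. *)
Lemma smooth_chart_ext (c : chart R n M) (a : 'rV[R]_n) (r : R)
    (h : 'rV[R]_n -> R) :
  @atlas _ _ M c -> 0 < r -> closed_ball a r `<=` c @` cdom c ->
  smooth_on (c @` cdom c) h -> (forall x, h x != 0 -> closed_ball a r x) ->
  smooth (chart_ext c h).
Proof.
move=> ac r0 ball_sub sh supp c' ac' k.
pose K := cinv c @` closed_ball a r.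
have clK : closed K.
  apply: compact_closed; first exact: manifold_hausdorff.
  apply: continuous_compact.
    exact: continuous_subspaceW (@cinv_continuous _ _ _ c).
  apply: bounded_closed_compact; last exact: closed_ball_closed.
  exists (`|a| + r); split=> [|m ltm x]; first exact: num_real.
  rewrite closed_ballE // /closed_ball_ /= => axr.
  rewrite (le_trans _ (ltW ltm)) // -[x](subrK a) addrC.
  by rewrite (le_trans (ler_normD _ _)) // lerD2l distrC.
apply: Ck_on_local => _ [q cq' <-].
have [cq|ncq] := pselect (cdom c q).
  have oV := chart_image_open (c := c') (@cdom_open _ _ _ c).
  exists (c' @` (cdom c' `&` cdom c)); first by exists q.
  apply: (@Ck_on_eq _ _ k _ (h \o (fun x => c (cinv c' x)))) => //.
    by move=> _ [s [c's cs] <-]; rewrite /= cmapK // chart_extE.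
  apply: (Ck_on_comp oV (@cimg_open _ _ _ c)) => [_ [s [c's cs] <-]|j|].
  - by rewrite cmapK //; exists s.
  - exact: atlas_compat ac' ac j k.
  - exact: sh.
have oV := chart_image_open (c := c') (closed_openC clK).
exists (c' @` (cdom c' `&` ~` K)).
  exists q => //; split => // -[x /ball_sub [s cs <-]].
  by rewrite cmapK // => sq; apply: ncq; rewrite -sq.
apply: Ck_on_eq (Ck_on_cst k 0 oV) => // _ [s [c's nKs] <-].
rewrite /= cmapK // /chart_ext; case: asboolP => // cs.
apply/esym/eqP; apply: contra_notT nKs => /supp bs.
by exists (c s) => //; rewrite cmapK.
Qed.

Section CoordinateField.
Variables (c : chart R n M) (a : 'rV[R]_n) (r : R).
Hypotheses (ac : @atlas _ _ M c) (r0 : 0 < r)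
  (ball_sub : closed_ball a r `<=` c @` cdom c).

Let b := box_bump a r.

Let smooth_bump : smooth_on (c @` cdom c) b.
Proof. by move=> k; apply: Ck_on_sub (Ck_on_box_bump k a r). Qed.

Let smooth_read (f : Cinfty M) : smooth_on (c @` cdom c) (f \o cinv c).
Proof. by have /asboolP := smooth_valP f; apply. Qed.

Let derivable_read (f : Cinfty M) q i : cdom c q ->
  derivable (f \o cinv c) (c q) (delta_mx 0 i).
Proof.
by move=> cq; have [_ /(_ i) [df _]] := smooth_read f 1; apply: df; exists q.
Qed.

Definition coord_field_val (i : 'I_n) (q : M) (f : Cinfty M) : R :=
  chart_ext c (fun x => b x * 'D_(delta_mx 0 i) (f \o cinv c) x) q.

Lemma coord_field_derivation i q : coord_field_val i q \in derivation_pred q.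
Proof.
apply/asboolP; rewrite /coord_field_val /chart_ext; case: asboolP => cq; last first.
  by split=> [s f g|f g]; rewrite ?mulr0 ?mul0r addr0.
split=> [s f g|f g].
  have -> : (s *: f + g : Cinfty M) \o cinv c =
            s \*: (f \o cinv c) + (g \o cinv c) by [].
  rewrite deriveD; [|apply: derivableZ; exact: derivable_read|exact: derivable_read].
  rewrite deriveZ; last exact: derivable_read.
  by rewrite -[s *: _]/(s * _) /=; ring.
have -> : (f * g : Cinfty M) \o cinv c = (f \o cinv c) * (g \o cinv c) by [].
rewrite deriveM; [|exact: derivable_read|exact: derivable_read].
by rewrite -![_ *: _]/(_ * _) /= cmapK //; ring.
Qed.

Lemma coord_field_smooth i (f : Cinfty M) :
  (fun q => Tangent (coord_field_derivation i q) f) \in smooth_pred M.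
Proof.
apply/asboolP; apply: (@smooth_chart_ext c a r) => // [k|x].
  apply: Ck_onM; [exact: cimg_open|exact: smooth_bump|].
  by have [_ /(_ i) []] := smooth_read f k.+1.
by rewrite mulf_eq0 negb_or => /andP[bx _]; exact: box_bump_support bx.
Qed.

Definition coord_field i : vector_field M := VectorField (coord_field_smooth i).

(** Tangent vectors act on global functions, so the coordinate functions are cut off as well; they
    serve to test independence of the coordinate fields. *)
Lemma coord_fun_smooth j : chart_ext c (fun x => b x * (x 0 j - a 0 j)) \in smooth_pred M.
Proof.
apply/asboolP; apply: (@smooth_chart_ext c a r) => // [k|x].
  apply: Ck_onM; [exact: cimg_open|exact: smooth_bump|].
  apply: Ck_onD; [exact: cimg_open|exact/Ck_on_coord/cimg_open|].
  exact/Ck_on_cst/cimg_open.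
by rewrite mulf_eq0 negb_or => /andP[bx _]; exact: box_bump_support bx.
Qed.

Definition coord_fun j : Cinfty M := SmoothFun (coord_fun_smooth j).

(** In the derivative of [b * (x_j - a_j)] at [a], the term containing the derivative of [b] has the
    factor [x_j - a_j], which is 0 there. One [b a] comes from the field and one from the
    function. *)
Lemma coord_field_fun i j p : cdom c p -> c p = a ->
  coord_field i p (coord_fun j) = b a ^+ 2 *+ (i == j).
Proof.
move=> cp pa; rewrite /= /coord_field_val chart_extE // pa.
have Ua : (c @` cdom c) a by rewrite -pa; exists p.
rewrite (@near_eq_derive _ _ _ _ (b * (fun x : 'rV[R]_n => x 0 j - a 0 j))); last first.
  apply: (near_open_eq (@cimg_open _ _ _ c)) => // _ [q cq <-].
  by rewrite /= cmapK // chart_extE.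
have dc : is_derive a (delta_mx 0 i) (fun x : 'rV[R]_n => x 0 j - a 0 j)
    ((delta_mx 0 i : 'rV[R]_n) 0 j).
  have := is_deriveD (is_derive_coord a (delta_mx 0 i) j)
    (is_derive_cst (- a 0 j) a (delta_mx 0 i)).
  by rewrite addr0.
rewrite deriveM; last by have [] := dc.
  have [_ ->] := dc; rewrite subrr scale0r addr0 -[_ *: _]/(_ * _) !mxE /=.
  by rewrite eq_sym; case: (i == j); rewrite ?mulr0 // mulr1.
have [_ /(_ i) [db _]] := smooth_bump 1; exact: db.
Qed.

End CoordinateField.

End FromChart.

(** The square matrix expressing [x] in [e] has trivial left kernel, hence is invertible, and its
    inverse converts coefficients on [e] into coefficients on [x]. *)
Lemma free_generates (K : fieldType) (V : lmodType K) n (e x : 'I_n -> V) :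
  (forall v, exists c : 'I_n -> K, v = \sum_i c i *: e i) ->
  (forall u : 'rV[K]_n, \sum_i u 0 i *: x i = 0 -> u = 0) ->
  forall v, exists c : 'I_n -> K, v = \sum_i c i *: x i.
Proof.
move=> gen_e free_x v.
have /choice[A xA] i : exists c : 'I_n -> K, x i = \sum_j c j *: e j by exact: gen_e.
pose B : 'M[K]_n := \matrix_(i, j) A i j.
have comb (u : 'rV[K]_n) : \sum_i u 0 i *: x i = \sum_j (u *m B) 0 j *: e j.
  transitivity (\sum_i \sum_j (u 0 i * A i j) *: e j).
    by apply: eq_bigr => i _; rewrite xA scaler_sumr; apply: eq_bigr => j _; rewrite scalerA.
  rewrite exchange_big /=; apply: eq_bigr => j _; rewrite mxE scaler_suml.
  by apply: eq_bigr => i _; rewrite mxE.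
have uB : B \in unitmx.
  rewrite -row_free_unit; apply: inj_row_free => u uB0; apply: free_x.
  by rewrite comb uB0; apply: big1 => j _; rewrite mxE scale0r.
have [c vc] := gen_e v.
exists (fun i => ((\row_j c j) *m invmx B) 0 i).
rewrite comb mulmxKV // vc; apply: eq_bigr => j _; by rewrite mxE.
Qed.

Section Extension.
Context {R : realType} {n : nat} {M : manifold R n}.

Lemma vf_sumE (X : 'I_n -> vector_field M) p : (\sum_i X i) p = \sum_i X i p.
Proof. exact: (big_morph (fun X : vector_field M => X p)). Qed.

Lemma tangent_sumE p (v : 'I_n -> tangent p) (f : Cinfty M) :
  (\sum_i v i) f = \sum_i v i f.
Proof. exact: (big_morph (fun v : tangent p => v f)). Qed.

Lemma exists_vector_field (g : lorentz_metric M) (p : M) (v : tangent p) :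
  exists X : vector_field M, X p = v.
Proof.
have [e [gen_e _]] := metric_signature g p.
have [c ac cp] := atlas_cover p.
have : nbhs (c p) (c @` cdom c).
  by apply: open_nbhs_nbhs; split; [exact: cimg_open|exists p].
move=> /nbhs_closedballP[r ball_sub].
have r0 : 0 < r%:num by [].
pose X i := coord_field ac r0 ball_sub i.
have [|k ->] := free_generates (x := fun i => X i p) gen_e _ v; last first.
  by exists (\sum_i k i *: X i); rewrite vf_sumE.
(* Testing the vanishing combination on the [j]-th cut-off coordinate isolates [u 0 j] times a
   nonzero square. *)
move=> u u0; apply/rowP => j; rewrite mxE.
have := congr1 (fun w : tangent p => w (coord_fun ac r0 ball_sub j)) u0.
rewrite tangent_sumE (bigD1 j) //= big1 => [|i ij].
  rewrite addr0 -[LHS]/(u 0 j * X j p (coord_fun ac r0 ball_sub j)).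
  rewrite coord_field_fun // eqxx -[RHS]/(0 : R) => /eqP.
  by rewrite mulf_eq0 expf_eq0 /= (negbTE (box_bump_center _ _)) // orbF => /eqP.
rewrite -[LHS]/(u 0 i * X i p (coord_fun ac r0 ball_sub j)).
by rewrite coord_field_fun // (negbTE ij) mulr0.
Qed.

Lemma extendE (g : lorentz_metric M) (p : M) (v : tangent p) : extend v p = v.
Proof. exact: (xgetPex 0 (exists_vector_field g v)). Qed.

End Extension.

(** * Algebra of the Lie bracket *)

Section VectorFieldCalculus.
Context {R : realType} {n : nat} {M : manifold R n}.
Implicit Types (X Y Z : vector_field M) (f h : Cinfty M) (p : M).

Lemma tangentD p (v : tangent p) f h : v (f + h) = v f + v h.
Proof. by have /asboolP [l _] := tangent_valP v; rewrite -[f]scale1r l mul1r scale1r. Qed.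

Lemma tangentZ p (v : tangent p) a f : v (a *: f) = a * v f.
Proof.
have /asboolP [l _] := tangent_valP v.
have v0 : v 0 = 0 by have := l (-1) 0 0; rewrite scaler0 addr0; lra.
by rewrite -[a *: f]addr0 l v0 addr0.
Qed.

Lemma tangent0 p (v : tangent p) : v 0 = 0.
Proof. by rewrite -[X in v X](scale0r (0 : Cinfty M)) tangentZ mul0r. Qed.

Lemma tangentN p (v : tangent p) f : v (- f) = - v f.
Proof. by rewrite -scaleN1r tangentZ mulN1r. Qed.

Lemma tangentB p (v : tangent p) f h : v (f - h) = v f - v h.
Proof. by rewrite tangentD tangentN. Qed.

Lemma tangentM p (v : tangent p) f h : v (f * h) = v f * h p + f p * v h.
Proof. by have /asboolP [_ ->] := tangent_valP v. Qed.

Lemma tangent_eq p (v w : tangent p) : (forall f, v f = w f) -> v = w.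
Proof. by move=> vw; apply: val_inj; apply/funext. Qed.

Lemma Cinfty_eq f h : (forall p, f p = h p) -> f = h.
Proof. by move=> fh; apply: val_inj; apply/funext. Qed.

Lemma lie_bracketE X Y p f :
  lie_bracket X Y p f = X p (vf_app Y f) - Y p (vf_app X f).
Proof. by []. Qed.

Lemma lie_bracketC X Y : lie_bracket X Y = - lie_bracket Y X.
Proof.
apply: vf_eqP => p; apply: tangent_eq => f.
by rewrite -[RHS]/(- (lie_bracket Y X p f)) !lie_bracketE opprB.
Qed.

Lemma lie_bracketDr X Y Z :
  lie_bracket X (Y + Z) = lie_bracket X Y + lie_bracket X Z.
Proof.
apply: vf_eqP => p; apply: tangent_eq => f.
rewrite -[RHS]/(lie_bracket X Y p f + lie_bracket X Z p f) !lie_bracketE.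
have -> : vf_app (Y + Z) f = vf_app Y f + vf_app Z f by apply: Cinfty_eq.
rewrite tangentD -[(Y + Z) p _]/(Y p (vf_app X f) + Z p (vf_app X f)); ring.
Qed.

Lemma lie_bracket_fscaler X h Y : lie_bracket X (vf_fscale h Y) =
  vf_fscale (vf_app X h) Y + vf_fscale h (lie_bracket X Y).
Proof.
apply: vf_eqP => p; apply: tangent_eq => f.
rewrite -[RHS]/(X p h * Y p f + h p * lie_bracket X Y p f) !lie_bracketE.
have -> : vf_app (vf_fscale h Y) f = h * vf_app Y f by apply: Cinfty_eq.
rewrite tangentM -[(vf_fscale h Y) p _]/(h p * Y p (vf_app X f)) /=; ring.
Qed.

Lemma lie_bracketZr X a Y : lie_bracket X (a *: Y) = a *: lie_bracket X Y.
Proof.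
apply: vf_eqP => p; apply: tangent_eq => f.
rewrite -[RHS]/(a * lie_bracket X Y p f) !lie_bracketE.
have -> : vf_app (a *: Y) f = a *: vf_app Y f by apply: Cinfty_eq.
rewrite tangentZ -[(a *: Y) p _]/(a * Y p (vf_app X f)); ring.
Qed.

Lemma lie_bracketNr X Y : lie_bracket X (- Y) = - lie_bracket X Y.
Proof. by rewrite -scaleN1r lie_bracketZr scaleN1r. Qed.

Lemma lie_bracketDl X Y Z :
  lie_bracket (X + Y) Z = lie_bracket X Z + lie_bracket Y Z.
Proof. by rewrite lie_bracketC lie_bracketDr opprD -!lie_bracketC. Qed.

Lemma lie_bracketZl a X Y : lie_bracket (a *: X) Y = a *: lie_bracket X Y.
Proof. by rewrite lie_bracketC lie_bracketZr -scalerN -lie_bracketC. Qed.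

(** The Jacobi identity in derivation form: the bracket with a bracket is the commutator of the two
    bracket operators. *)
Lemma lie_bracket_jacobi X Y Z : lie_bracket (lie_bracket X Y) Z =
  lie_bracket X (lie_bracket Y Z) - lie_bracket Y (lie_bracket X Z).
Proof.
apply: vf_eqP => p; apply: tangent_eq => f.
rewrite -[RHS]/(lie_bracket X (lie_bracket Y Z) p f -
               lie_bracket Y (lie_bracket X Z) p f) !lie_bracketE.
have E U W : vf_app (lie_bracket U W) f = vf_app U (vf_app W f) - vf_app W (vf_app U f).
  exact: Cinfty_eq.
by rewrite !E !tangentB /=; ring.
Qed.

End VectorFieldCalculus.

(** * The Lie derivative of the metric *)

Section Evaluation.
Context {R : realType} {n : nat} {M : manifold R n}.

(** Evaluation as a ring morphism, so that matrix and determinant identities over [Cinfty M] can be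
    specialised at a point. *)
Definition Cinfty_eval (p : M) (f : Cinfty M) : R := f p.

Lemma Cinfty_eval_is_zmod_morphism p : zmod_morphism (Cinfty_eval p).
Proof. by []. Qed.

Lemma Cinfty_eval_is_monoid_morphism p : monoid_morphism (Cinfty_eval p).
Proof. by []. Qed.

HB.instance Definition _ p := GRing.isZmodMorphism.Build (Cinfty M) R
  (Cinfty_eval p) (Cinfty_eval_is_zmod_morphism p).
HB.instance Definition _ p := GRing.isMonoidMorphism.Build (Cinfty M) R
  (Cinfty_eval p) (Cinfty_eval_is_monoid_morphism p).

End Evaluation.

Section MetricLieDerivative.
Context {R : realType} {n : nat} {M : manifold R n} (g : lorentz_metric M).
Implicit Types (X Y Z V W : vector_field M) (f h : Cinfty M) (p : M).

Lemma metricDr p (u v w : tangent p) : g p u (v + w) = g p u v + g p u w.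
Proof. by rewrite -[v]scale1r metric_linear mul1r scale1r. Qed.

Lemma metric0r p (u : tangent p) : g p u 0 = 0.
Proof. by have := metric_linear g u (-1) 0 0; rewrite scaler0 addr0 mulN1r addNr. Qed.

Lemma metricZr p (u : tangent p) a (v : tangent p) : g p u (a *: v) = a * g p u v.
Proof. by rewrite -[a *: v]addr0 metric_linear metric0r addr0. Qed.

Lemma metricNr p (u v : tangent p) : g p u (- v) = - g p u v.
Proof. by rewrite -scaleN1r metricZr mulN1r. Qed.

Lemma metricDl p (u v w : tangent p) : g p (v + w) u = g p v u + g p w u.
Proof. by rewrite Defs.metric_sym metricDr !(Defs.metric_sym _ u). Qed.

Lemma metric0l p (u : tangent p) : g p 0 u = 0.
Proof. by rewrite Defs.metric_sym metric0r. Qed.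

Lemma metricZl p (u : tangent p) a (v : tangent p) : g p (a *: v) u = a * g p v u.
Proof. by rewrite Defs.metric_sym metricZr Defs.metric_sym. Qed.

Lemma metricNl p (u v : tangent p) : g p (- v) u = - g p v u.
Proof. by rewrite Defs.metric_sym metricNr Defs.metric_sym. Qed.

Lemma metric_sumr p (u : tangent p) (v : 'I_n -> tangent p) :
  g p u (\sum_i v i) = \sum_i g p u (v i).
Proof. by apply: (big_morph (g p u)); [exact: metricDr|exact: metric0r]. Qed.

Lemma metric_suml p (u : tangent p) (v : 'I_n -> tangent p) :
  g p (\sum_i v i) u = \sum_i g p (v i) u.
Proof. by rewrite Defs.metric_sym metric_sumr; apply: eq_bigr => i _; exact: Defs.metric_sym. Qed.

(** Pairing with an orthonormal basis vector returns the matching coefficient of [v] up to sign. *)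
Lemma metric_nondegenerate p (v : tangent p) : (forall w, g p w v = 0) -> v = 0.
Proof.
have [e [gen_e orth_e]] := metric_signature g p.
have [c ->] := gen_e v => v0; apply: big1 => j _.
have := v0 (e j); rewrite metric_sumr (bigD1 j) //= big1 => [|i ij].
  rewrite metricZr orth_e eqxx addr0; case: ifP => _.
    by rewrite mulrN1 => /eqP; rewrite oppr_eq0 => /eqP ->; rewrite scale0r.
  by rewrite mulr1 => ->; rewrite scale0r.
by rewrite metricZr orth_e eq_sym (negbTE ij) mulr0.
Qed.

(** The Lie derivative of [g] on global fields, free of chosen extensions; being valued in
    [Cinfty M], it can be differentiated again. *)
Definition lie_metric X V W : Cinfty M :=
  vf_app X (metric_app g V W) - metric_app g (lie_bracket X V) W
  - metric_app g V (lie_bracket X W).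

Lemma lie_metricE X V W p : lie_metric X V W p =
  X p (metric_app g V W) - g p (lie_bracket X V p) (W p)
  - g p (V p) (lie_bracket X W p).
Proof. by []. Qed.

Lemma metric_appC V W : metric_app g V W = metric_app g W V.
Proof. by apply: Cinfty_eq => p; exact: Defs.metric_sym. Qed.

Lemma metric_appDl V V' W :
  metric_app g (V + V') W = metric_app g V W + metric_app g V' W.
Proof. by apply: Cinfty_eq => p; exact: metricDl. Qed.

Lemma metric_app_fscalel f V W :
  metric_app g (vf_fscale f V) W = f * metric_app g V W.
Proof. by apply: Cinfty_eq => p; exact: metricZl. Qed.

Lemma lie_metricC X V W : lie_metric X V W = lie_metric X W V.
Proof.
apply: Cinfty_eq => p; rewrite !lie_metricE metric_appC.
by rewrite (Defs.metric_sym _ (W p)) (Defs.metric_sym _ _ (V p)) addrAC.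
Qed.

Lemma lie_metricDl X V V' W :
  lie_metric X (V + V') W = lie_metric X V W + lie_metric X V' W.
Proof.
apply: Cinfty_eq => p.
rewrite -[RHS]/(lie_metric X V W p + lie_metric X V' W p) !lie_metricE.
rewrite metric_appDl tangentD lie_bracketDr.
rewrite -[(_ + lie_bracket X V') p]/(lie_bracket X V p + lie_bracket X V' p).
rewrite -[(V + V') p]/(V p + V' p) !metricDl; ring.
Qed.

(** The derivative of [f] along [X] arises once from [X (f g(V, W))] and once from [[X, f V]], and
    the two cancel. *)
Lemma lie_metric_fscalel X f V W :
  lie_metric X (vf_fscale f V) W = f * lie_metric X V W.
Proof.
apply: Cinfty_eq => p.
rewrite -[RHS]/(f p * lie_metric X V W p) !lie_metricE.
rewrite metric_app_fscalel tangentM lie_bracket_fscaler.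
rewrite -[(_ + vf_fscale f _) p]/(X p f *: V p + f p *: lie_bracket X V p).
rewrite -[(vf_fscale f V) p]/(f p *: V p) metricDl !metricZl /=; ring.
Qed.

Lemma lie_metric0l X W : lie_metric X 0 W = 0.
Proof.
have := lie_metricDl X 0 0 W; rewrite addr0 => /eqP.
by rewrite -subr_eq0 opprD addNKr oppr_eq0 => /eqP.
Qed.

Lemma lie_metric_suml X (V : 'I_n -> vector_field M) W :
  lie_metric X (\sum_i V i) W = \sum_i lie_metric X (V i) W.
Proof.
apply: (big_morph (fun V => lie_metric X V W)); last exact: lie_metric0l.
by move=> V1 V2; exact: lie_metricDl.
Qed.

(* The fields E_i extending an orthonormal basis at p form a frame wherever their
   Gram determinant h is nonzero, and there Z vanishes; hence h * Z = 0 globally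
   and no cut-off function is needed. *)
Lemma lie_metric_local X V W p : V p = 0 -> lie_metric X V W p = 0.
Proof.
move=> Vp0; have [e [gen_e orth_e]] := metric_signature g p.
have /choice[E Ep] i : exists E : vector_field M, E p = e i.
  exact: exists_vector_field g _ _.
pose G : 'M[Cinfty M]_n := \matrix_(i, j) metric_app g (E i) (E j).
pose b : 'rV[Cinfty M]_n := \row_j metric_app g V (E j).
(* Cramer's rule without division: where [h] is nonzero these are [h] times the frame coefficients
   of [V], and they are smooth everywhere. *)
pose k i := (b *m \adj G) 0 i.
have [h hE] : exists h, h = \det G by exists (\det G).
pose Z : vector_field M := vf_fscale h V - \sum_i vf_fscale (k i) (E i).
have detG q : h q = \det (map_mx (Cinfty_eval q) G).
  by rewrite det_map_mx -hE.
have hp : h p != 0.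
  rewrite detG.
  have -> : map_mx (Cinfty_eval p) G =
      diag_mx (\row_(i < n) (if (i : nat) == 0%N then -1 else 1)).
    apply/matrixP => i j; rewrite !mxE /Cinfty_eval /= !Ep orth_e.
    by case: (i == j).
  rewrite det_diag; apply/prodf_neq0 => i _; rewrite mxE.
  by case: ifP => _; rewrite ?oppr_eq0 oner_eq0.
have ZE q : Z q = h q *: V q - \sum_i k i q *: E i q.
  by rewrite -[Z q]/(h q *: V q - (\sum_i vf_fscale (k i) (E i)) q) vf_sumE.
(* This is [\adj G *m G = h] times the identity, read in column [j]. *)
have orthZ q j : g q (Z q) (E j q) = 0.
  have kG : \sum_i k i q * g q (E i q) (E j q) = h q * g q (V q) (E j q).
    have : (b *m \adj G *m G) 0 j = (h *: b) 0 j.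
      by rewrite -mulmxA mul_adj_mx -hE mul_mx_scalar.
    rewrite !mxE => /(congr1 (Cinfty_eval q)); rewrite rmorph_sum rmorphM /= => kG.
    by rewrite -[RHS]kG; apply: eq_bigr => i _; rewrite [G _ _]mxE.
  rewrite ZE metricDl metricZl metricNl metric_suml -kG.
  apply/eqP; rewrite subr_eq0; apply/eqP; apply: eq_bigr => i _.
  by rewrite metricZl.
have hZ : vf_fscale h Z = 0.
  apply: vf_eqP => q; rewrite -[LHS]/(h q *: Z q) -[RHS]/(0 : tangent q).
  have [->|hq] := eqVneq (h q) 0; first by rewrite scale0r.
  suff -> : Z q = 0 by rewrite scaler0.
  have [f [gen_f _]] := metric_signature g q.
  have gen_E := free_generates (x := fun i => E i q) gen_f.
  apply: metric_nondegenerate => w; have [u u0|c ->] := gen_E _ w.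
    (* A linear relation among the [E i q] would be a kernel vector of the Gram matrix, forcing
       [h q = 0]. *)
    apply/eqP; apply: contraTT hq => un0; rewrite negbK detG.
    apply/det0P; exists u => //; apply/rowP => j; rewrite !mxE.
    transitivity (g q (\sum_i u 0 i *: E i q) (E j q)); last by rewrite u0 metric0l.
    by rewrite metric_suml; apply: eq_bigr => i _; rewrite metricZl !mxE.
  rewrite metric_suml; apply: big1 => i _.
  by rewrite metricZl Defs.metric_sym orthZ mulr0.
have hp' : Cinfty_eval p h != 0 by exact: hp.
have ZD : Z = vf_fscale h V + \sum_i vf_fscale (- k i) (E i).
  congr (_ + _); rewrite -sumrN; apply: eq_bigr => i _.
  by apply: vf_eqP => q; exact/esym/scaleNr.
have LZ : Cinfty_eval p h * Cinfty_eval p (lie_metric X Z W) = 0.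
  by rewrite -rmorphM -lie_metric_fscalel hZ lie_metric0l rmorph0.
have : Cinfty_eval p h * Cinfty_eval p (lie_metric X V W) = 0.
  have : Cinfty_eval p (lie_metric X Z W) = 0.
    by move/eqP: LZ; rewrite mulf_eq0 (negbTE hp') => /eqP.
  (* At [p] every [k i] vanishes, being a combination of the values [g p (V p) (E j p)] with
     [V p = 0]; only the term in [V] survives. *)
  rewrite ZD lie_metricDl lie_metric_suml lie_metric_fscalel rmorphD rmorphM.
  rewrite rmorph_sum big1 ?addr0 // => i _.
  rewrite lie_metric_fscalel rmorphM rmorphN /k mxE rmorph_sum big1 ?oppr0 ?mul0r //.
  move=> j _; rewrite rmorphM mxE -[X in X * _]/(g p (V p) (E j p)).
  by rewrite Vp0 metric0l mul0r.
by move/eqP; rewrite mulf_eq0 (negbTE hp') => /eqP.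
Qed.

Lemma lie_metric_tensorl X V V' W p :
  V p = V' p -> lie_metric X V W p = lie_metric X V' W p.
Proof.
move=> VV'; have : lie_metric X (V - V') W p = 0.
  by apply: lie_metric_local; rewrite -[LHS]/(V p - V' p) VV' subrr.
rewrite lie_metricDl -[LHS]/(lie_metric X V W p + lie_metric X (- V') W p).
have -> : lie_metric X (- V') W = - lie_metric X V' W.
  apply/eqP; rewrite -subr_eq0 opprK -lie_metricDl addNr lie_metric0l //.
by move=> /eqP; rewrite subr_eq0 => /eqP.
Qed.

(** Links the pointwise definition to fields: by tensoriality, and symmetry for the second slot, the
    chosen extensions may be replaced by [V] and [W]. *)
Lemma lie_derivativeE X V W p :
  lie_derivative g X (V p) (W p) = lie_metric X V W p.
Proof.
rewrite -[LHS]/(lie_metric X (extend (V p)) (extend (W p)) p).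
rewrite (@lie_metric_tensorl _ _ V) ?(extendE g) // lie_metricC.
by rewrite (@lie_metric_tensorl _ _ W) ?(extendE g) // lie_metricC.
Qed.

End MetricLieDerivative.

(** * Nil-Killing vector fields *)

Section NilKilling.
Context {R : realType} {n : nat} {M : manifold R n} (g : lorentz_metric M).
Variable l : vector_field M.
Hypothesis hl : null_field g l.
Implicit Types (X Y V W : vector_field M) (p : M).

(** Nondegeneracy provides [U] with [g(U, l)] nonzero at [p]. The field [g(U, l) V - g(V, l) U] is
    orthogonal to [l] everywhere and equals a nonzero multiple of [w] at [p], which [c]
    normalises. *)
Lemma extend_orthogonal p (w : tangent p) : g p w (l p) = 0 ->
  exists2 W, Defs.orthogonal g l W & W p = w.
Proof.
move=> wl; have [_ lp0] := hl p.
have [u ul] : exists u, g p u (l p) != 0.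
  apply: contrapT => /forallNP H; apply: lp0; apply: (@metric_nondegenerate _ _ _ g) => u.
  by apply: contrapT => ne0; apply: (H u); apply/eqP.
have [U Uu] := exists_vector_field g u.
have [V Vw] := exists_vector_field g w.
pose c := (g p u (l p))^-1.
exists (c *: (vf_fscale (metric_app g U l) V + - vf_fscale (metric_app g V l) U)).
  move=> q /=; rewrite -[X in g q X _]/(c *: (g q (U q) (l q) *: V q +
    - (g q (V q) (l q) *: U q))).
  by rewrite metricZl metricDl metricNl !metricZl; ring.
rewrite -[LHS]/(c *: (g p (U p) (l p) *: V p + - (g p (V p) (l p) *: U p))).
by rewrite Uu Vw wl scale0r subr0 scalerA mulVf // scale1r.
Qed.

(** Nilpotency can be tested on global fields, where brackets make sense, since arbitrary and
    orthogonal tangent vectors extend to fields of the same kind. *)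
Lemma nil_killingP X : nil_killing g l X <->
  (forall W, lie_metric g X l W = 0) /\
  (forall V W, Defs.orthogonal g l V -> Defs.orthogonal g l W -> lie_metric g X V W = 0).
Proof.
split=> [nX|[H1 H2] p].
  split=> [W|V W oV oW]; apply: Cinfty_eq => p; rewrite -lie_derivativeE.
    by have [H _] := nX p; rewrite H.
  by have [_ H] := nX p; rewrite H; [|exact: oV|exact: oW].
split=> [z|v w /extend_orthogonal[V oV <-] /extend_orthogonal[W oW <-]].
  by have [Z <-] := exists_vector_field g z; rewrite lie_derivativeE H1.
by rewrite lie_derivativeE H2.
Qed.

Lemma lie_metric_linear a X Y V W : lie_metric g (a *: X + Y) V W =
  a *: lie_metric g X V W + lie_metric g Y V W.
Proof.
apply: Cinfty_eq => p.
rewrite -[RHS]/(a * lie_metric g X V W p + lie_metric g Y V W p) !lie_metricE.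
rewrite !lie_bracketDl !lie_bracketZl.
rewrite -[(_ + lie_bracket Y V) p]/(a *: lie_bracket X V p + lie_bracket Y V p).
rewrite -[(_ + lie_bracket Y W) p]/(a *: lie_bracket X W p + lie_bracket Y W p).
rewrite -[(a *: X + Y) p _]/(a * X p (metric_app g V W) + Y p (metric_app g V W)).
by rewrite metricDl metricZl metricDr metricZr; ring.
Qed.

(** The two groups are L_X (L_Y g) and L_Y (L_X g) on [(V, W)]; after the Jacobi identity the mixed
    terms cancel. *)
Lemma lie_metric_bracket X Y V W : lie_metric g (lie_bracket X Y) V W =
  (vf_app X (lie_metric g Y V W) - lie_metric g Y (lie_bracket X V) W
    - lie_metric g Y V (lie_bracket X W))
  - (vf_app Y (lie_metric g X V W) - lie_metric g X (lie_bracket Y V) W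
    - lie_metric g X V (lie_bracket Y W)).
Proof.
apply: Cinfty_eq => p.
rewrite -[RHS]/((X p (lie_metric g Y V W) - lie_metric g Y (lie_bracket X V) W p
    - lie_metric g Y V (lie_bracket X W) p)
  - (Y p (lie_metric g X V W) - lie_metric g X (lie_bracket Y V) W p
    - lie_metric g X V (lie_bracket Y W) p)).
have E (U V' W' Z : vector_field M) : U p (lie_metric g Z V' W') = U p (vf_app Z (metric_app g V' W'))
    - U p (metric_app g (lie_bracket Z V') W') - U p (metric_app g V' (lie_bracket Z W')).
  by rewrite /lie_metric !tangentB.
have B (U V' : vector_field M) : (U - V') p = U p + - V' p :> tangent p by [].
rewrite !E !lie_metricE !lie_bracket_jacobi lie_bracketE !B.
by rewrite !metricDl !metricDr !metricNl !metricNr; ring.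
Qed.

(** Expand [(L_X g)(W, l) = 0]: [g(W, l)] is identically 0 and [[X, l]] is a multiple of [l], which
    leaves only [g([X, W], l)]. *)
Lemma bracket_orthogonal X W : g_alg g l X -> Defs.orthogonal g l W ->
  Defs.orthogonal g l (lie_bracket X W).
Proof.
move=> [[f Xl] /nil_killingP [H _]] oW p.
have gWl0 : metric_app g W l = 0 by apply: Cinfty_eq => q; exact: oW.
have : lie_metric g X W l p = 0 by rewrite lie_metricC H.
rewrite lie_metricE gWl0 tangent0 Xl -[vf_fscale f l p]/(f p *: l p) metricZr.
by rewrite oW mulr0 subr0 sub0r => /eqP; rewrite oppr_eq0 => /eqP.
Qed.

Lemma vf_app0 X : vf_app X 0 = 0.
Proof. by apply: Cinfty_eq => p; exact: tangent0. Qed.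

Lemma g_alg_bracket X Y : g_alg g l X -> g_alg g l Y -> g_alg g l (lie_bracket X Y).
Proof.
move=> gX gY; have oX := bracket_orthogonal gX; have oY := bracket_orthogonal gY.
case: gX gY => [[f Xl] /nil_killingP[X1 X2]] [[h Yl] /nil_killingP[Y1 Y2]].
split.
  (* From [[X, h l] - [Y, f l]], where the terms in [f h] cancel. *)
  exists (vf_app X h - vf_app Y f).
  rewrite lie_bracket_jacobi Xl Yl !lie_bracket_fscaler Xl Yl.
  apply: vf_eqP => p.
  rewrite -[LHS]/((X p h *: l p + h p *: (f p *: l p)) -
                 (Y p f *: l p + f p *: (h p *: l p))).
  rewrite -[RHS]/((X p h - Y p f) *: l p) !scalerA scalerBl (mulrC (h p)).
  by rewrite opprD addrACA subrr addr0.
apply/nil_killingP; split=> [W|V W oV oW]; rewrite lie_metric_bracket.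
  (* Every term has [l] or a multiple of [l] in its first slot. *)
  rewrite X1 Y1 Xl Yl !lie_metric_fscalel !X1 !Y1 !vf_app0.
  by rewrite !mulr0 !subr0.
(* Brackets of [X] and [Y] with [V] and [W] stay orthogonal to [l], so every term pairs two
   orthogonal fields. *)
rewrite (X2 V W) // (Y2 V W) // !vf_app0.
by rewrite !X2 ?Y2 ?subr0 //; first [exact: oX | exact: oY].
Qed.

Lemma g_alg_subspace : linear_subspace (g_alg g l).
Proof.
have lin a X Y : g_alg g l X -> g_alg g l Y -> g_alg g l (a *: X + Y).
  move=> [[f Xl] /nil_killingP[X1 X2]] [[h Yl] /nil_killingP[Y1 Y2]]; split.
    exists (a *: f + h); rewrite lie_bracketDl lie_bracketZl Xl Yl.
    apply: vf_eqP => p; rewrite -[LHS]/(a *: (f p *: l p) + h p *: l p).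
    by rewrite -[RHS]/((a * f p + h p) *: l p) scalerA scalerDl.
  apply/nil_killingP; split=> [W|V W oV oW]; rewrite lie_metric_linear.
    by rewrite X1 Y1 scaler0 addr0.
  by rewrite X2 // Y2 // scaler0 addr0.
split; last exact: lin.
split.
  exists 0; have := lie_bracketZl 0 0 l; rewrite !scale0r => ->.
  by apply: vf_eqP => p; exact/esym/scale0r.
have L0 V W : lie_metric g 0 V W = 0.
  by have := lie_metric_linear (-1) 0 0 V W; rewrite scaler0 addr0 scaleN1r addNr.
by apply/nil_killingP; split=> *; exact: L0.
Qed.

Lemma orthogonal_linear a X Y : Defs.orthogonal g l X -> Defs.orthogonal g l Y ->
  Defs.orthogonal g l (a *: X + Y).
Proof.
move=> oX oY p; rewrite -[X in g p X _]/(a *: X p + Y p) metricDl metricZl.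
by rewrite oX oY mulr0 addr0.
Qed.

End NilKilling.

Theorem proposition2p5 (R : realType) (n : nat) (M : manifold R n)
  (g : lorentz_metric M) (l : vector_field M) (hl : null_field g l) :
  is_lie_algebra (@lie_bracket R n M) (g_alg g l) /\
  is_lie_ideal (@lie_bracket R n M) (h_alg g l) (g_alg g l).
Proof.
have [g0 glin] := g_alg_subspace hl.
have altb (X : vector_field M) : lie_bracket X X = 0.
  by apply: vf_eqP => p; apply: tangent_eq => f; rewrite lie_bracketE subrr.
split; split.
- by split.
- by move=> X Y; exact: g_alg_bracket.
- by move=> a X Y Z _ _ _; rewrite lie_bracketDl lie_bracketZl.
- by move=> a X Y Z _ _ _; rewrite lie_bracketDr lie_bracketZr.
- by move=> X _; exact: altb.
(* The cyclic form follows from the derivation form by antisymmetry in the last two summands. *)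
- move=> X Y Z _ _ _; rewrite (lie_bracketC Z (lie_bracket X Y)) lie_bracket_jacobi.
  by rewrite (lie_bracketC Z X) lie_bracketNr subrr.
- by move=> X [].
- split=> [|a X Y [oX pX nX] [oY pY nY]].
    by split; [move=> p; exact: metric0l|exact: g0.1|exact: g0.2].
  have [pXY nXY] := glin a X Y (conj pX nX) (conj pY nY).
  by split => //; exact: orthogonal_linear.
(* Elements of [h_alg] are those of [g_alg] orthogonal to [l], so beyond closure of [g_alg] only
   orthogonality has to be added. *)
- move=> X Y gX [oY pY nY].
  have [pXY nXY] := g_alg_bracket hl gX (conj pY nY).
  by split => //; exact: bracket_orthogonal.
Qed.
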